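(* Let $k$ be a non-negative integer and $n$ a positive integer. Let $p_1, p_2,\ldots,p_{k+1}$ be primes such that $p_i \equiv 3 \pmod 4$ for each $1 \leq i \leq k+1$. Then for any integer $j \not\equiv 0 \pmod{p_{k+1}}$, we have $$B_{4} \left( p_1^2 p_2^2 \cdots p_k^2 p_{k+1}^2 n + \frac{p_1^2 p_2^2 \cdots p_k^2 p_{k+1}\left(4j+ p_{k+1}\right)-1}{4} \right) \equiv 0 \pmod 4.$$
   Context: A partition is $4$-regular if none of its parts is divisible by $4$. $B_4(n)$ denotes the number of ordered pairs $(\lambda,\mu)$ of $4$-regular partitions whose parts together sum to $n$; equivalently $\sum_{n\ge0}B_4(n)q^n=\frac{(q^4;q^4)_\infty^2}{(q;q)_\infty^2}$, where $(q^k;q^k)_\infty=\prod_{i\ge1}(1-q^{ki})$. *)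

(* Defs.v *)
From mathcomp Require Import all_boot all_order all_algebra.

Set Implicit Arguments.
Unset Strict Implicit.
Unset Printing Implicit Defensive.

(* A partition is the weakly decreasing sequence of its positive parts. *)
Definition is_partition (s : seq nat) : bool :=
  sorted geq s && all (fun x => 0 < x) s.

Definition regular_partition (l : nat) (s : seq nat) : bool :=
  is_partition s && all (fun x => ~~ (l %| x)) s.

Definition regular_pair (l n : nat) (lm : seq nat * seq nat) : bool :=
  [&& regular_partition l lm.1, regular_partition l lm.2
    & sumn lm.1 + sumn lm.2 == n].

Definition seq_of_bseq (n : nat) (s : n.-bseq 'I_n.+1) : seq nat :=
  [seq val i | i <- s].

(* In a pair of partitions of total weight n there are at most n parts on each
   side, and each of them is at most n; hence counting inside the finite type
   of sequences of length <= n with entries in {0, .., n} loses nothing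
   (B_unique below). *)
Definition B (l n : nat) : nat :=
  #|[set lm : n.-bseq 'I_n.+1 * n.-bseq 'I_n.+1
      | regular_pair l n (seq_of_bseq lm.1, seq_of_bseq lm.2)]|.

(* No pair of partitions has negative weight. *)
Definition Bz (l : nat) (m : int) : nat :=
  if m is Posz n then B l n else 0.

Lemma partition_bseq n s : is_partition s -> sumn s <= n ->
  exists t : n.-bseq 'I_n.+1, seq_of_bseq t = s.
Proof.
move=> /andP[_ pos] le_sn.
have szs : size s <= n.
  apply: leq_trans le_sn; elim: s pos => //= x s IHs /andP[x0 /IHs].
  by rewrite -add1n; apply: leq_add.
have les : {in s, forall x, x < n.+1}.
  move=> x xs; rewrite ltnS; apply: leq_trans le_sn.
  by rewrite (perm_sumn (perm_to_rem xs)) /= leq_addr.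
have szt : size [seq inord x : 'I_n.+1 | x <- s] <= n by rewrite size_map.
exists (Bseq szt); rewrite /seq_of_bseq /= -map_comp -[RHS]map_id.
by apply/eq_in_map => x /les /= lt_xn; rewrite inordK.
Qed.

Lemma B_unique l n (s : seq (seq nat * seq nat)) :
  uniq s -> (forall lm, (lm \in s) = regular_pair l n lm) -> size s = B l n.
Proof.
move=> us sE; rewrite /B cardE.
set f := fun lm : n.-bseq 'I_n.+1 * n.-bseq 'I_n.+1 =>
  (seq_of_bseq lm.1, seq_of_bseq lm.2).
have sI : injective (@seq_of_bseq n).
  by move=> a b /(inj_map val_inj) /val_inj.
have fI : injective f by move=> [a b] [c d] [/sI -> /sI ->].
rewrite -(size_map f); apply/perm_size/uniq_perm => //.
  by rewrite map_inj_uniq ?enum_uniq.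
move=> lm; rewrite sE; apply/idP/mapP => [H|[x]]; last first.
  by rewrite mem_enum inE => ? ->.
case: lm H => a b H; have /and3P[/andP[/= pa _] /andP[pb _] /eqP e] := H.
have [|a' ea] := partition_bseq (n := n) pa; first by rewrite -e leq_addr.
have [|b' eb] := partition_bseq (n := n) pb; first by rewrite -e leq_addl.
by exists (a', b'); rewrite ?mem_enum ?inE /f /= ea eb.
Qed.

(* Main.v *)
Require Import Defs.
From mathcomp Require Import all_boot all_order all_algebra.
From mathcomp Require Import finfield.
From mathcomp Require Import ring zify.
Import GRing.Theory.

(* If c(a) is the number of 4-regular partitions of a, then B_4(N) is the
   self-convolution sum c(a) c(N - a).  Modulo 2 the generating function of c is
   f_4 / f_1 = f_2 ^ 2 / f_1, f_k = (q^k; q^k), which by Gauss' identity is the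
   sum of q^T over the triangular numbers T; so c(a) is even unless a is
   triangular.  If a and N - a are both triangular, then 2(4N + 1) is a sum of
   two squares, which is impossible when a prime p = 3 mod 4 divides 4N + 1 to
   an odd power.  Hence every product c(a) c(N - a) has an even factor, and the
   symmetry a <-> N - a provides the second factor 2. *)

(** * Regular partitions with bounded parts, and the convolution formula *)

Definition bounded_regular (l k n : nat) (s : seq nat) : bool :=
  [&& path geq k s, all (fun x => 0 < x) s, all (fun x => ~~ (l %| x)) s
    & sumn s == n].

(* [f] is fuel; any [f >= n + k] gives the same list up to permutation. *)
Fixpoint regular_list (l f k n : nat) : seq (seq nat) :=
  match f, k with
  | f'.+1, k'.+1 => regular_list l f' k' n
      ++ (if ~~ (l %| k) && (k <= n)
          then [seq k :: s | s <- regular_list l f' k (n - k)] else [::])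
  | _, _ => if n == 0 then [:: [::]] else [::]
  end.

Lemma mem_regular_list l f k n s : n + k <= f ->
  (s \in regular_list l f k n) = bounded_regular l k n s.
Proof.
have base m t : (t \in if m == 0 then [:: [::]] else [::]) =
    bounded_regular l 0 m t.
  by rewrite /bounded_regular; case: t => [|[|x] t]; case: m => //=;
    rewrite ?inE ?andbF.
elim: f k n s => [|f IHf] [|k] n s; rewrite ?addnS //= => le_f; rewrite ?base //.
 rewrite mem_cat IHf; last by lia.
set b := _ && _.
have -> : (s \in if b then [seq k.+1 :: t | t <- regular_list l f k.+1 (n - k.+1)]
    else [::]) =
    [&& head 0 s == k.+1, b & behead s \in regular_list l f k.+1 (n - k.+1)].
  case: b => /=; last by rewrite andbF.
  apply/mapP/andP => [[t ts ->] //=|[hs ts]].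
  by exists (behead s) => //; case: s hs {ts} => //= x s /eqP ->.
case: s => [|x s]; first by rewrite orbF.
rewrite /bounded_regular /=.
have [->|nx] := eqVneq x k.+1; last first.
  rewrite orbF; congr [&& _ && _, _, _ & _]; lia.
rewrite ltnn leqnn /= /b.
have [nl|] := boolP (l %| k.+1); first by rewrite /= !andbF.
have [le_k|gt_k] /= := leqP k.+1 n; last first.
  have -> : (k.+1 + sumn s == n) = false by lia.
  by rewrite !andbF.
rewrite IHf; last by lia.
move=> _; rewrite /bounded_regular; congr [&& _, _, _ & _]; lia.
Qed.

Lemma uniq_regular_list l f k n : n + k <= f -> uniq (regular_list l f k n).
Proof.
elim: f k n => [|f IHf] [|k] n /=; do 1?[by case: n].
move=> le_f; rewrite cat_uniq IHf /=; last by lia.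
case: ifP => //= /andP[_ le_k].
rewrite map_inj_uniq; last by move=> ? ? [].
rewrite IHf ?andbT; last by lia.
apply/hasPn => _ /mapP[t _ ->]; rewrite mem_regular_list; last by lia.
by rewrite /bounded_regular /= ltnn.
Qed.

Definition nregular (l k n : nat) : nat := size (regular_list l (n + k) k n).

Lemma size_regular_list l f k n : n + k <= f ->
  size (regular_list l f k n) = nregular l k n.
Proof.
move=> le_f; apply/perm_size/uniq_perm; rewrite ?uniq_regular_list //.
by move=> s; rewrite !mem_regular_list.
Qed.

Lemma nregular0 l n : nregular l 0 n = (n == 0).
Proof. by rewrite /nregular; case: n. Qed.

(** Either [k.+1] is not a part, or removing one copy of it leaves a partition of [n - k.+1] with
    the same bound on its parts. *)
Lemma nregularS l k n : nregular l k.+1 n = nregular l k n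
  + (if ~~ (l %| k.+1) && (k < n) then nregular l k.+1 (n - k.+1) else 0).
Proof.
rewrite {1}/nregular addnS /= size_cat size_regular_list //; congr (_ + _).
have [/andP[_ le_k]|] := boolP (_ && _) => //.
by rewrite size_map size_regular_list //; lia.
Qed.

Lemma bounded_regularE l k n s : n <= k ->
  bounded_regular l k n s = regular_partition l s && (sumn s == n).
Proof.
move=> le_nk; rewrite /bounded_regular /regular_partition /is_partition -!andbA.
case: eqP => [sn|]; last by rewrite !andbF.
by congr (_ && _); case: s sn => //= x s sn; rewrite (_ : x <= k) //; lia.
Qed.

(** The pairs are listed by the weight [a] of their first partition; [B_unique] turns this
    duplicate-free list into a count. *)
Lemma B_convolution l n :
  B l n = \sum_(a < n.+1) nregular l n a * nregular l n (n - a).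
Proof.
pose L a := regular_list l (n + n) n a.
have memL a s : a <= n ->
    (s \in L a) = regular_partition l s && (sumn s == a).
  by move=> le_an; rewrite mem_regular_list ?bounded_regularE ?leq_add2r.
have uL a : a <= n -> uniq (L a).
  by move=> le_an; rewrite uniq_regular_list ?leq_add2r.
pose P a := [seq (s, t) | s <- L a, t <- L (n - a)].
have memP a u : u \in P a -> a <= n ->
    regular_pair l n u /\ sumn u.1 = a.
  move=> /allpairsP[[s t] /= [sL tL ->]] le_an.
  move: sL tL; rewrite !memL ?leq_subr // => /andP[rs /eqP es] /andP[rt /eqP et].
  by rewrite /regular_pair /= rs rt es et subnKC /=.
rewrite -(@B_unique l n [seq u | a <- iota 0 n.+1, u <- P a]).
- rewrite size_allpairs_dep sumnE big_map -[iota 0 n.+1]/(index_iota 0 n.+1).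
  rewrite big_mkord; apply: eq_bigr => a _.
  by rewrite size_allpairs !size_regular_list //; have := ltn_ord a; lia.
- apply: allpairs_uniq_dep; first exact: iota_uniq.
    move=> a; rewrite mem_iota add0n ltnS /= => le_an.
    by apply: allpairs_uniq; rewrite ?uL ?leq_subr // => -[? ?] [? ?].
  move=> [a u] [b v] /allpairsPdep[a' [u' [ai uP [-> ->]]]].
  move=> /allpairsPdep[b' [v' [bi vP [-> ->]]]] /= uv.
  rewrite -uv in vP *; move: ai bi; rewrite !mem_iota !ltnS /= => ai bi.
  by have [_ <-] := memP _ _ uP ai; have [_ <-] := memP _ _ vP bi.
- move=> u; apply/allpairsPdep/idP => [[a [v [ai vP ->]]]|ru].
    by have [] := memP _ _ vP; rewrite // -ltnS -[a < _]/(0 <= a < 0 + n.+1) -mem_iota.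
  have /and3P[r1 r2 /eqP e] := ru.
  exists (sumn u.1), u; split=> //.
    by rewrite mem_iota ltnS /= -e leq_addr.
  apply/allpairsP; exists u; split=> //; last by case: (u).
    by rewrite memL ?r1 ?eqxx // -e leq_addr.
  by rewrite memL ?leq_subr // r2 -e addKn eqxx.
Qed.

(** Write each value of [f] as its parity plus twice its half. The product of the parities vanishes,
    and the reflection of [a] to [n - a] identifies the two mixed sums; each has coefficient 2, so
    together they give a multiple of 4. *)
Lemma dvd4_self_convolution (f : nat -> nat) (n : nat) :
  (forall a, a <= n -> ~~ odd (f a) || ~~ odd (f (n - a))) ->
  4 %| \sum_(a < n.+1) f a * f (n - a).
Proof.
move=> ev.
pose u a := odd (f a) * (f (n - a))./2.
have swap : \sum_(a < n.+1) odd (f (n - a)) * (f a)./2 = \sum_(a < n.+1) u a.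
  rewrite (reindex_inj rev_ord_inj); apply: eq_bigr => a _ /=.
  by rewrite /u subSS subKn // -ltnS.
have -> : \sum_(a < n.+1) f a * f (n - a) = 4 * (\sum_(a < n.+1) u a
    + \sum_(a < n.+1) (f a)./2 * (f (n - a))./2).
  rewrite mulnDr (mulnDl 2 2) -{1}swap !big_distrr /= -!big_split /=.
  apply: eq_bigr => a _; rewrite /u.
  have := ev a; rewrite -ltnS => /(_ (ltn_ord a)).
  move: (f a) (f (n - a)) => x y.
  move: (odd_double_half x) (odd_double_half y).
  move: (odd x) (x./2) (odd y) (y./2) => b x' c y' <- <-; rewrite -!muln2.
  by case: b; case: c => //= _; ring.
exact: dvdn_mulr.
Qed.

(** * Gauss' identity and the parity of the number of 4-regular partitions *)

Local Open Scope ring_scope.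

(* Shanks' finite form of Gauss' identity, with denominators cleared: modulo
   'X^(2n + 1) only the term s = 0 survives on the right. *)
Lemma shanks_gauss (R : comNzRingType) (n : nat) :
  (\prod_(i < n) (1 - 'X^(i.*2.+1))) * (\sum_(s < n.*2) 'X^('C(s.+1, 2)))
  = \sum_(s < n) (\prod_(i < s) (1 - 'X^(i.*2.+1)))
      * (\prod_(s <= i < n) (1 - 'X^(i.*2.+2))) * 'X^(s * n.*2.+1)
  :> {poly R}.
Proof.
pose D m : {poly R} := \prod_(i < m) (1 - 'X^(i.*2.+1)).
pose N s m : {poly R} := \prod_(s <= i < m) (1 - 'X^(i.*2.+2)).
pose F m s := D s * N s m * 'X^(s * m.*2.+1).
rewrite -[LHS]/(D n * _) -[RHS]/(\sum_(s < n) F n s).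
elim: n => [|n IHn]; first by rewrite !big_ord0 mulr0.
(* [G] telescopes the discrepancy between [F n.+1 s] and [(1 - 'X^(n.*2.+1)) * F n s]; it vanishes
   at 0, so only [G n] survives summation. *)
pose G s := (1 - 'X^(s.*2)) * F n s.
have step s : (s < n)%N -> F n.+1 s = (1 - 'X^(n.*2.+1)) * F n s + (G s.+1 - G s).
  move=> lt_sn; rewrite /G /F /N big_nat_recr ?(ltnW lt_sn) //=.
  rewrite (big_ltn lt_sn) /D big_ord_recr /=.
  set d := \prod_(_ < _) _; set m := \prod_(_ <= _ < _) _.
  rewrite !doubleS.
  have -> : 'X^(s * n.*2.+3) = 'X^(s * n.*2.+1) * 'X^(s.*2) :> {poly R}.
    by rewrite -exprD; congr ('X^_); lia.
  have -> : 'X^(s.+1 * n.*2.+1) = 'X^(s * n.*2.+1) * 'X^(n.*2) * 'X :> {poly R}.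
    by rewrite -exprD -exprSr; congr ('X^_); lia.
  rewrite !exprSr; ring.
have tele : \sum_(s < n) (G s.+1 - G s) = G n.
  rewrite -(big_mkord xpredT (fun s => G s.+1 - G s)) telescope_sumr //.
  by rewrite /G expr0 subrr mul0r subr0.
have -> : D n.+1 = D n * (1 - 'X^(n.*2.+1)) by rewrite /D big_ord_recr.
rewrite doubleS !big_ord_recr /=.
have -> : \sum_(s < n) F n.+1 s
    = (1 - 'X^(n.*2.+1)) * (\sum_(s < n) F n s) + G n.
  by rewrite -tele mulr_sumr -big_split; apply: eq_bigr => s _; apply: step.
rewrite -IHn /G /F /N big_geq // big_nat1 !doubleS.
have -> : 'C(n.*2.+1, 2) = (n * n.*2.+1)%N.
  by rewrite bin2 -muln2; lia.
have -> : 'C(n.*2.+2, 2) = (n * n.*2.+1 + n.*2.+1)%N.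
  by rewrite bin2 -muln2; lia.
have -> : (n * n.*2.+3 = n * n.*2.+1 + n.*2)%N by lia.
rewrite !exprD !exprSr; ring.
Qed.

Lemma nregular_ge l k n : (n <= k)%N -> nregular l k n = nregular l n n.
Proof.
move=> le_nk; apply/perm_size/uniq_perm; rewrite ?uniq_regular_list //.
by move=> s; rewrite !mem_regular_list // !bounded_regularE.
Qed.

Lemma dvdp_XnP (F : fieldType) m (p : {poly F}) :
  reflect (forall i, (i < m)%N -> p`_i = 0) ('X^m %| p).
Proof.
apply: (iffP idP) => [/dvdpP[q ->] i lt_im|p0]; first by rewrite coefMXn lt_im.
rewrite -[p](poly_take_drop m) dvdp_addl ?dvdp_mull // (_ : take_poly m p = 0).
  exact: dvdp0.
by apply/polyP=> i; rewrite coef_take_poly coef0; case: ifP => // /p0.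
Qed.

(** Power series identities are expressed as congruences modulo ['X^m]. Multiplying by
    [1 - 'X^(k.+1)] undoes the recurrence [nregularS] and lowers the bound from [k.+1] to [k]. *)
Lemma regular_generating (F : fieldType) l k m :
  'X^m %| (\prod_(i < k | ~~ (l %| i.+1)%N) (1 - 'X^(i.+1)) : {poly F})
       * \poly_(n < m) (nregular l k n)%:R - 1.
Proof.
elim: k => [|k IHk].
  apply/dvdp_XnP => i lt_im; rewrite big_ord0 mul1r coefB coef_poly lt_im.
  by rewrite nregular0 coef1 subrr.
rewrite big_mkcond big_ord_recr -big_mkcond /=.
set E := \prod_(_ < _ | _) _ in IHk *; set C := \poly_(_ < _) _ in IHk.
set C' := \poly_(_ < _) _; set u := if _ then _ else _.
have -> : E * u * C' - 1 = E * (u * C' - C) + (E * C - 1) by ring.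
rewrite dvdp_addl // dvdp_mull //; apply/dvdp_XnP => i lt_im.
rewrite /u coefB; have [dv|ndv] /= := boolP (l %| k.+1)%N.
  by rewrite mul1r !coef_poly lt_im nregularS dv /= addn0 subrr.
rewrite mulrBl mul1r coefB coefXnM !coef_poly lt_im nregularS ndv /=.
rewrite ltnS; have [le_ik|lt_ki] := leqP i k; first by rewrite addn0 subr0 subrr.
by rewrite (leq_ltn_trans (leq_subr _ _)) // natrD addrK subrr.
Qed.

(** Over ['F_2], the truncated generating function [C] and the triangular sum [T] agree modulo
    ['X^m]: with [E] taken at [4 * r], [E * C] is 1, [D * T] is [N r.*2], which is also [N r], and
    [E * N r * N r] equals [D * N r.*2]. *)
Lemma regular4_triangular (n : nat) :
  odd (nregular 4 n n) -> exists s, n = 'C(s.+1, 2).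
Proof.
pose P := {poly 'F_2}.
have two0 : 1 + 1 = 0 :> P.
  by apply/polyP => i; rewrite coefD coef1 coef0; case: i => [|i]; apply/eqP.
pose r := n.+1.
(* The precision [m] exceeds [n], yet is small enough that the factors of [N r.*2] beyond those of
   [N r] are 1 modulo ['X^m]. *)
pose m := r.*2.+1.
pose D : P := \prod_(i < r.*2) (1 - 'X^(i.*2.+1)).
pose N r : P := \prod_(0 <= i < r) (1 - 'X^(i.*2.+2)).
pose E r : P := \prod_(i < r | ~~ (4 %| i.+1)%N) (1 - 'X^(i.+1)).
pose T : P := \sum_(s < r.*2.*2) 'X^('C(s.+1, 2)).
pose C : P := \poly_(i < m) (nregular 4 (4 * r) i)%:R.
have EC : 'X^m %| E (4 * r)%N * C - 1 by apply: regular_generating.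
have DT : 'X^m %| D * T - N r.*2.
  rewrite /D /T shanks_gauss.
  rewrite -(big_mkord xpredT (fun s => (\prod_(i < s) (1 - 'X^(i.*2.+1)))
    * (\prod_(s <= i < r.*2) (1 - 'X^(i.*2.+2))) * 'X^(s * r.*2.*2.+1))) /=.
  rewrite big_ltn ?double_gt0 // big_ord0 mul0n expr0 mul1r mulr1.
  rewrite addrAC subrr add0r big_nat_cond.
  apply: (big_ind (fun q : P => 'X^m %| q)) => [|p q|i]; first exact: dvdp0.
    exact: dvdp_add.
  rewrite andbT => /andP[i_gt0 _]; rewrite dvdp_mull // dvdp_exp2l //.
  by rewrite /m; nia.
have NN : 'X^m %| N r.*2 - N r.
  rewrite /N (@big_cat_nat _ _ _ r) //=; last by rewrite -addnn leq_addr.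
  rewrite -[X in _ - X]mulr1 -mulrBr dvdp_mull //.
  rewrite big_nat_cond.
  apply: (big_ind (fun q : P => 'X^m %| q - 1)) => [|p q pm qm|i].
  - by rewrite subrr dvdp0.
  - rewrite (_ : p * q - 1 = p * (q - 1) + (p - 1)); last by ring.
    by rewrite dvdp_add // dvdp_mull.
  - rewrite andbT => /andP[le_ri _].
    by rewrite addrAC subrr add0r dvdpNr dvdp_exp2l // /m; lia.
(* In characteristic 2, [N q * N q] is the product of the [1 - 'X^(4i)]. *)
have EN q : E (4 * q)%N * N q * N q =
    \prod_(i < q.*2) (1 - 'X^(i.*2.+1)) * N q.*2.
  elim: q => [|q IHr]; first by rewrite muln0 /E /N !big_ord0 big_geq ?mulr1.
  have -> : N q.+1 = N q * (1 - 'X^(q.*2.+2)) by rewrite /N big_nat_recr.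
  have -> : N q.+1.*2 = N q.*2 * (1 - 'X^(q.*2.*2.+2)) * (1 - 'X^(q.*2.*2.+4)).
    by rewrite /N doubleS !big_nat_recr //=.
  have -> : E (4 * q.+1)%N = E (4 * q)%N * (1 - 'X^(q.*2.*2.+1))
      * (1 - 'X^(q.*2.*2.+2)) * (1 - 'X^(q.*2.*2.+3)).
    rewrite mulnS addnC /E !addnS addn0 big_mkcond !big_ord_recr -big_mkcond /=.
    have -> : (4 * q = q.*2.*2)%N by lia.
    do 3![rewrite ifT; last by lia].
    by rewrite ifF ?mulr1 //; lia.
  rewrite doubleS !big_ord_recr /=.
  set d := \prod_(_ < _) _ in IHr *.
  have sq : (1 - 'X^(q.*2.+2)) * (1 - 'X^(q.*2.+2)) = 1 - 'X^(q.*2.*2.+4) :> P.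
    have -> : (q.*2.*2.+4 = q.*2.+2 + q.*2.+2)%N by lia.
    rewrite exprD; set z := 'X^_.
    by apply/eqP; rewrite -subr_eq0 (_ : _ - _ = (1 + 1) * (z * z - z));
      [rewrite two0 mul0r | ring].
  rewrite -sq doubleS; set z := 1 - 'X^(q.*2.+2).
  ring: IHr.
(* [N r] has constant term 1, so its square can be cancelled modulo ['X^m]. *)
have NX : coprimep 'X^m (N r * N r).
  have N0 : (N r).[0] = 1.
    rewrite /N horner_prod big1 // => i _.
    by rewrite hornerD hornerN hornerXn hornerC expr0n subr0.
  rewrite coprimep_expl // coprimep_sym coprimepX.
  by rewrite rootE hornerM N0 mulr1 oner_eq0.
have CT : 'X^m %| C - T.
  rewrite -(Gauss_dvdpr _ NX).
  have -> : N r * N r * (C - T) = N r * N r * T * (E (4 * r)%N * C - 1)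
      - C * N r.*2 * (D * T - N r.*2) - C * (N r.*2 + N r) * (N r.*2 - N r).
    have -> : N r * N r * T * (E (4 * r)%N * C - 1) =
        (E (4 * r)%N * N r * N r - N r.*2 * D) * T * C
        + N r.*2 * D * T * C - N r * N r * T by ring.
    rewrite (EN r : _ = D * N r.*2) [N _ * D]mulrC subrr; ring.
  by rewrite !dvdp_sub ?dvdp_mull.
have := dvdp_XnP _ _ _ CT n; rewrite coefB coef_poly.
have lt_nm : (n < m)%N by rewrite /m /r; lia.
rewrite lt_nm => /(_ isT)/eqP.
rewrite subr_eq0 nregular_ge; last by rewrite /r; lia.
rewrite coef_sum => /eqP nT odd_n.
have : (nregular 4 n n)%:R != 0 :> 'F_2.
  by rewrite -(dvdn_pcharf (pchar_Fp (isT : prime 2))) dvdn2 odd_n.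
rewrite nT => T0; case: (pickP (fun s : 'I_r.*2.*2 => n == 'C(s.+1, 2))).
  by move=> s /eqP; exists s.
move=> noT; move: T0; rewrite big1 ?eqxx // => s _.
by rewrite coefXn noT.
Qed.

(** * Sums of two squares and primes congruent to 3 modulo 4 *)

Lemma prime3mod4_dvd_sum_squares (p x y : nat) : prime p -> p = 3 %[mod 4] ->
  (p %| x ^ 2 + y ^ 2)%N -> (p %| x)%N && (p %| y)%N.
Proof.
move=> p_pr p3.
have p_ch := pchar_Fp p_pr.
rewrite !(dvdn_pcharf p_ch) natrD !natrX => /eqP.
move: (x%:R : 'F_p) (y%:R : 'F_p) => {}x {}y xy.
have pE : p = ((p %/ 4).*2.+1.*2.+1)%N by lia.
have exp_even z : z ^+ ((p %/ 4).*2.+1).*2 = (z != 0)%:R :> 'F_p.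
  have : z ^+ ((p %/ 4).*2.+1.*2.+1) = z.
    by rewrite -[RHS]expf_card card_Fp //; congr (_ ^+ _).
  rewrite exprSr.
  have [-> _|z0 zp] := eqVneq z 0; first by rewrite expr0n.
  by apply: (mulIf z0); rewrite zp mul1r.
(* The exponent is [(p - 1) / 2], which is odd, so the sign survives. By Fermat each side is then 0
   or 1 up to that sign, and as [p] is not 2 both must be 0. *)
have : (x ^+ 2) ^+ (p %/ 4).*2.+1 = (- y ^+ 2) ^+ (p %/ 4).*2.+1.
  by congr (_ ^+ _); apply/eqP; rewrite -addr_eq0 xy.
rewrite exprNn -!exprM !mul2n !exp_even -signr_odd /= odd_double /= expr1.
case: eqVneq => [_|x0]; case: eqVneq => [_|y0] //=; rewrite ?mulN1r ?mulr0 ?oppr0.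
- by move=> /esym/eqP; rewrite oppr_eq0 oner_eq0.
- by move/eqP; rewrite oner_eq0.
- move=> /eqP; rewrite -addr_eq0 -natrD -(dvdn_pcharf p_ch) => p2.
  have := dvdn_leq (isT : 0 < 2)%N p2; lia.
Qed.

(** Descent on [x]: if [p] divides the sum, it divides both [x] and [y], and taking out [p ^ 2]
    lowers the valuation by 2. For [x = 0] the sum is a square. *)
Lemma logn_sum_squares (p x y : nat) : prime p -> p = 3 %[mod 4] ->
  ~~ odd (logn p (x ^ 2 + y ^ 2)).
Proof.
move=> p_pr p3; elim/ltn_ind: x y => x IHx y.
have [->|x0] := posnP x; first by rewrite add0n lognX mul2n odd_double.
have [/(prime3mod4_dvd_sum_squares _ _ _ p_pr p3)/andP[]|pn] :=
  boolP (p %| x ^ 2 + y ^ 2)%N; last by rewrite lognE (negbTE pn) !andbF.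
move=> /dvdnP[a xE] /dvdnP[b yE].
have p_gt0 := prime_gt0 p_pr; have p_gt1 := prime_gt1 p_pr.
have a0 : (0 < a)%N by case: a xE x0 => // ->.
rewrite xE yE !expnMn -mulnDl lognM ?expn_gt0 ?p_gt0 //; last first.
  by rewrite addn_gt0 expn_gt0 a0.
rewrite lognX mul2n oddD odd_double addbF; apply: IHx.
by rewrite xE -[X in (X < _)%N]muln1 ltn_pmul2l.
Qed.

(** * Divisibility of [B 4 n] by 4 *)

Lemma dvd4_B4 (p n : nat) : prime p -> p = 3 %[mod 4] ->
  odd (logn p (4 * n + 1)) -> (4 %| B 4 n)%N.
Proof.
move=> p_pr p3 odd_v; rewrite B_convolution; apply: dvd4_self_convolution.
move=> a le_an; rewrite -negb_and; apply/negP => /andP[].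
rewrite !nregular_ge ?leq_subr // => /regular4_triangular[s as_].
move=> /regular4_triangular[t at_].
have := logn_sum_squares p s.*2.+1 t.*2.+1 p_pr p3.
(* Eight times a triangular number plus 1 is an odd square. The factor 2 does not change the
   valuation at the odd prime [p]. *)
have -> : (s.*2.+1 ^ 2 + t.*2.+1 ^ 2 = 2 * (4 * n + 1))%N.
  have tri u : (u.*2.+1 ^ 2 = 8 * 'C(u.+1, 2) + 1)%N.
    rewrite bin2 /=; have := odd_double_half (u.+1 * u).
    rewrite oddM /= andNb add0n -!muln2; nia.
  by rewrite !tri; lia.
rewrite lognM //; last by rewrite addn1.
rewrite oddD odd_v lognE dvdn_prime2 //.
have -> : (p == 2) = false by case: eqP p3 => // ->.
by rewrite !andbF.
Qed.

Theorem theorem1p8 (k n : nat) (p : nat -> nat) (j : int)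
  (n_gt0 : (0 < n)%N)
  (p_prime : forall i : nat, (1 <= i <= k.+1)%N -> prime (p i))
  (p_mod4 : forall i : nat, (1 <= i <= k.+1)%N -> (p i = 3 %[mod 4])%N)
  (j_mod : (j <> 0 %[mod (p k.+1)%:Z])%Z) :
  (Bz 4
    (((\prod_(1 <= i < k.+1) (p i)%:Z ^+ 2) * (p k.+1)%:Z ^+ 2 * n%:Z
     + (((\prod_(1 <= i < k.+1) (p i)%:Z ^+ 2) * (p k.+1)%:Z
          * (4%:Z * j + (p k.+1)%:Z) - 1) %/ 4)%Z)%R)
  = 0 %[mod 4])%N.
Proof.
have p_pr : prime (p k.+1) by apply: p_prime; rewrite leqnn.
have p3 : (p k.+1 = 3 %[mod 4])%N by apply: p_mod4; rewrite leqnn.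
(* Only [q ^ 2] enters: it is 1 modulo 4, and its valuation at the last prime is even, even if that
   prime recurs among the earlier ones. *)
pose q := (\prod_(1 <= i < k.+1) p i)%N.
have odd_q : odd q.
  rewrite /q big_nat_cond; apply: (big_ind odd) => // [x y ox oy|i].
    by rewrite oddM ox.
  rewrite andbT => /andP[i1 ik]; have := p_mod4 i; rewrite i1 ltnW //.
  by move=> /(_ isT); lia.
have q_gt0 : (0 < q)%N by case: (q) odd_q.
have -> : \prod_(1 <= i < k.+1) (p i)%:Z ^+ 2 = q%:Z ^+ 2.
  by rewrite prodrXl /q (big_morph Posz PoszM (erefl _)).
move: (p k.+1) p_pr p3 j_mod => {p_prime p_mod4}r r_pr r3 j_mod.
set z := 4%:Z * (r%:Z * n%:Z + j) + r%:Z.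
set x := _ + _.
have xE : 4 * x + 1 = q%:Z ^+ 2 * r%:Z * z.
  (* The division by 4 is exact because [q ^ 2] and [r ^ 2] are both 1 modulo 4. *)
  have dv : (4 %| q%:Z ^+ 2 * r%:Z * (4%:Z * j + r%:Z) - 1)%Z.
    have [u uE] : exists u : nat, (q ^ 2)%N = (4 * u + 1)%N.
      exists (q ^ 2 %/ 4)%N; rewrite -{1}(odd_double_half q) odd_q; nia.
    have [v vE] : exists v : nat, (r ^ 2)%N = (4 * v + 1)%N.
      exists (r ^ 2 %/ 4)%N; rewrite {1}(divn_eq r 4) r3; nia.
    apply/dvdzP; exists (q%:Z ^+ 2 * r%:Z * j + 4 * u%:Z * v%:Z + u%:Z + v%:Z).
    have -> : q%:Z ^+ 2 * r%:Z * (4 * j + r%:Z) =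
      q%:Z ^+ 2 * r%:Z * j * 4 + (q ^ 2)%N%:Z * (r ^ 2)%N%:Z.
      rewrite -!mulnn !PoszM; ring.
    have lift w : (4 * w + 1)%N%:Z = 4 * w%:Z + 1 by lia.
    rewrite uE vE !lift; ring.
  rewrite /x mulrDr [4 * (_ %/ 4)%Z]mulrC divzK // /z; ring.
(* For negative [x], [Bz] is 0 by definition. *)
case: x xE => [N|//] xE; rewrite /Bz.
apply/eqP; rewrite mod0n -/(dvdn 4 _); apply: (dvd4_B4 r) => //.
(* Modulo [r], [z] is [4 * j], and 4 is invertible; so [r] dividing [z] would force [r] to divide
   [j]. The valuation of [4 * N + 1] at [r] is thus that of [q ^ 2 * r], which is odd. *)
have ndvd : ~~ (r %| `|z|)%N.
  apply/negP => r_z; apply: j_mod; apply/eqP; rewrite eqz_mod_dvd subr0.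
  have : (r %| 4%:Z * j)%Z.
    rewrite (_ : 4%:Z * j = z - (4 * n%:Z + 1) * r%:Z); last by rewrite /z; ring.
    by rewrite rpredB // dvdz_mull.
  rewrite Gauss_dvdzr // coprimezE /= prime_coprime // -[4%N]/(2 ^ 2)%N.
  by rewrite Euclid_dvdX // dvdn_prime2 //; case: eqP => // r2; move: r3; rewrite r2.
have -> : (4 * N + 1 = q ^ 2 * r * `|z|)%N.
  by apply/eqP; rewrite -eqz_nat; lia.
have z_gt0 : (0 < `|z|)%N by case: posnP ndvd => // ->; rewrite dvdn0.
rewrite !lognM ?muln_gt0 ?expn_gt0 ?q_gt0 ?(prime_gt0 r_pr) //.
rewrite addnn oddD oddD odd_double logn_prime // eqxx /=.
by rewrite lognE (negbTE ndvd) !andbF.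
Qed.
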